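(* Let $f:X\to X$ be a continuous map on a separable complete metric space $(X,d)$, let $\overline{f}:\mathcal{K}(X)\to\mathcal{K}(X)$ be the induced map on the hyperspace of non-empty compact subsets of $X$, and let $\hat{f}$ be the Zadeh extension of $f$ to the space $\mathcal{F}(X)$ of normal fuzzy sets, where $\mathcal{F}_\infty(X)=(\mathcal{F}(X),d_\infty)$ and $\mathcal{F}_0(X)=(\mathcal{F}(X),d_0)$ denote this space with the supremum metric and with the Skorokhod metric, respectively. Then the following statements are equivalent: (i) $f:X\to X$ is quasi-rigid; (ii) $\overline{f}:\mathcal{K}(X)\to \mathcal{K}(X)$ is quasi-rigid; (iii) $\hat{f}:\mathcal{F}_{\infty}(X)\to \mathcal{F}_{\infty}(X)$ is quasi-rigid; (iv) $\hat{f}:\mathcal{F}_{0}(X)\to \mathcal{F}_{0}(X)$ is quasi-rigid.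
   Context: $\mathbb{N}$ is the set of strictly positive integers. Quasi-rigidity: a continuous self-map $g:Y\to Y$ of a topological space $Y$ is quasi-rigid if there exist a (strictly) increasing sequence of positive integers $(n_k)_{k\in\mathbb{N}}$ and a dense set $Z\subset Y$ such that $g^{n_k}(y)\to y$ as $k\to\infty$ for every $y\in Z$. $\mathcal{K}(X)$ is the set of all non-empty compact subsets of $X$, endowed with the Vietoris topology, whose basic open sets are $\mathcal{V}(U_1,\dots,U_N)=\{K\in\mathcal{K}(X)\;;\;K\subset\bigcup_{j=1}^N U_j,\ K\cap U_j\neq\varnothing \text{ for all } 1\le j\le N\}$ with $N\in\mathbb{N}$ and $U_1,\dots,U_N\subset X$ non-empty open; for a metric space $(X,d)$ this is the topology of the Hausdorff metric $d_H(K_1,K_2)=\max\{\max_{x_1\in K_1}d(x_1,K_2),\max_{x_2\in K_2}d(x_2,K_1)\}$. The map $\overline{f}:\mathcal{K}(X)\to\mathcal{K}(X)$ is $\overline{f}(K):=f(K)$. Fuzzy sets: for a function $u:X\to[0,1]$ put $u_\alpha:=\{x\in X\;;\;u(x)\ge\alpha\}$ for $\alpha\in(0,1]$ and $u_0:=\overline{\{x\in X\;;\;u(x)>0\}}$ (closure in $X$). $\mathcal{F}(X)$ is the set of normal fuzzy sets: the upper-semicontinuous functions $u:X\to[0,1]$ such that $u_0$ is compact and $u_1$ is non-empty. Zadeh extension: $\hat{f}(u)(x):=\sup\{u(y)\;;\;y\in f^{-1}(x)\}$ if $f^{-1}(x)\neq\varnothing$, and $\hat{f}(u)(x):=0$ if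 $f^{-1}(x)=\varnothing$. For continuous $f$ on a metric space, $\hat f$ is a well-defined self-map of $\mathcal{F}(X)$, continuous for both metrics below. Supremum metric: $d_\infty(u,v):=\sup_{\alpha\in[0,1]}d_H(u_\alpha,v_\alpha)$ for $u,v\in\mathcal{F}(X)$. Skorokhod metric: $d_0(u,v):=\inf\{\varepsilon\;;\;\text{there is }\xi\in\mathcal{T}\text{ with }\sup_{\alpha\in[0,1]}|\xi(\alpha)-\alpha|\le\varepsilon\text{ and }d_\infty(u,\xi\circ v)\le\varepsilon\}$, where $\mathcal{T}$ is the set of strictly increasing homeomorphisms $\xi:[0,1]\to[0,1]$. *)

(* Defs.v *)
From HB Require Import structures.
From mathcomp Require Import all_boot all_order all_algebra.
From mathcomp Require Import all_classical all_reals.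
From mathcomp Require Import topology normedtype realfun.

Set Implicit Arguments.
Unset Strict Implicit.
Unset Printing Implicit Defensive.

Import Order.TTheory GRing.Theory Num.Theory.
Import numFieldNormedType.Exports.

Local Open Scope classical_set_scope.
Local Open Scope ring_scope.

Definition quasi_rigid (Y : topologicalType) (g : Y -> Y) : Prop :=
  exists n : nat -> nat,
    [/\ forall k, (0 < n k)%N, {homo n : i j / (i < j)%N} &
      exists Z : set Y, dense Z /\
        forall y, Z y -> (fun k => iter (n k) g y) @ \oo --> y].

Definition separable_space (T : topologicalType) : Prop :=
  exists D : set T, countable D /\ dense D.

(* The library's completeType is always pointed, which would rule out the empty
   space. *)
Definition complete_space (T : uniformType) : Prop :=
  forall u : nat -> T, cauchy (u @ \oo) -> exists l : T, u @ \oo --> l.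

Record hyperspace (X : topologicalType) := Hyperspace {
  hyper_set :> set X ;
  hyper_compact : compact hyper_set ;
  hyper_nonempty : hyper_set !=set0 }.

HB.instance Definition _ (X : topologicalType) := gen_eqMixin (hyperspace X).
HB.instance Definition _ (X : topologicalType) := gen_choiceMixin (hyperspace X).

Definition vietoris_open (X : topologicalType) (J : Type) (U : J -> set X) :
    set (hyperspace X) :=
  [set K : hyperspace X | K `<=` \bigcup_j U j /\
    forall j, (K : set X) `&` U j !=set0].

Definition vietoris_base (X : topologicalType) : set (set (hyperspace X)) :=
  [set V | exists (N : nat) (U : 'I_N -> set X),
    [/\ (0 < N)%N, forall j, open (U j), forall j, U j !=set0 &
        V = vietoris_open U]].

Section vietoris.
Variable X : topologicalType.

Lemma vietoris_base_fin (J : finType) (j0 : J) (U : J -> set X) :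
  (forall j, open (U j)) -> (forall j, U j !=set0) ->
  vietoris_base (vietoris_open U).
Proof.
move=> oU U0; exists #|J|, (U \o enum_val); split => //.
- by apply/card_gt0P; exists j0.
- by move=> j; exact: oU.
- by move=> j; exact: U0.
apply/seteqP; split => K [KU Kj]; split.
- move=> x /KU [j _ Ujx]; exists (enum_rank j) => //=.
  by rewrite enum_rankK.
- by move=> j; exact: Kj.
- by move=> x /KU [j _ Ujx]; exists (enum_val j).
- by move=> j; have := Kj (enum_rank j); rewrite /= enum_rankK.
Qed.

Lemma vietoris_base_cover :
  \bigcup_(V in @vietoris_base X) V = setT.
Proof.
apply/seteqP; split => // K _.
exists (vietoris_open (fun _ : unit => [set: X])).
  apply: (@vietoris_base_fin _ (tt : unit)) => j; first exact: openT.
  by have [x _] := hyper_nonempty K; exists x.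
split; first by move=> x _; exists tt.
by move=> _; have [x Kx] := hyper_nonempty K; exists x.
Qed.

Lemma vietoris_base_join (V W : set (hyperspace X)) (K : hyperspace X) :
  @vietoris_base X V -> @vietoris_base X W -> V K -> W K ->
  exists O, [/\ @vietoris_base X O, O K & O `<=` V `&` W].
Proof.
move=> [N [U [N0 oU U0 ->]]] [M [T [M0 oT T0 ->]]] [KU KUj] [KT KTj].
pose O (s : 'I_N + 'I_M) : set X := match s with
  | inl i => U i `&` \bigcup_j T j
  | inr j => T j `&` \bigcup_i U i end.
have oO s : open (O s).
  by case: s => i /=; apply: openI => //; apply: bigcup_open.
have KO s : (K : set X) `&` O s !=set0.
  case: s => i /=.
    by have [x [Kx Ux]] := KUj i; exists x; split => //; split => //; exact: KT.
  by have [x [Kx Ux]] := KTj i; exists x; split => //; split => //; exact: KU.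
exists (vietoris_open O); split.
- apply: vietoris_base_fin => // [|s]; first exact: (inl (Ordinal N0)).
  by have [x [_ ?]] := KO s; exists x.
- split=> // x Kx; have [i _ Ui] := KU _ Kx; exists (inl i) => //.
  by split => //; exact: KT.
- move=> L [LO LOj]; split; split.
  + by move=> x /LO [[i|i] _ [+ [j _ ?]]] => ?; [exists i|exists j].
  + by move=> i; have [x [? [? _]]] := LOj (inl i); exists x.
  + by move=> x /LO [[i|i] _ [+ [j _ ?]]] => ?; [exists j|exists i].
  + by move=> i; have [x [? [? _]]] := LOj (inr i); exists x.
Qed.

HB.instance Definition _ := @isBaseTopological.Build (hyperspace X)
  (set (hyperspace X)) (@vietoris_base X) id vietoris_base_cover
  (fun V W K => @vietoris_base_join V W K).

End vietoris.

Section hyper_map.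
Variables (X : topologicalType) (f : X -> X).
Hypothesis cf : continuous f.

Lemma hyper_map_compact (K : hyperspace X) : compact (f @` K).
Proof.
apply: continuous_compact; last exact: hyper_compact.
exact: continuous_subspaceT.
Qed.

Lemma hyper_map_nonempty (K : hyperspace X) : f @` K !=set0.
Proof. by have [x Kx] := hyper_nonempty K; exists (f x), x. Qed.

Definition hyper_map (K : hyperspace X) : hyperspace X :=
  Hyperspace (hyper_map_compact (K := K)) (hyper_map_nonempty K).

End hyper_map.

Definition level (R : realType) (X : topologicalType) (u : X -> R) (a : R) :
    set X :=
  if a == 0 then closure [set x | 0 < u x] else [set x | a <= u x].

Definition is_fuzzy (R : realType) (X : topologicalType) (u : X -> R) : Prop :=
  [/\ forall x, 0 <= u x <= 1,
      forall x a, u x < a -> \forall y \near x, u y < a,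
      compact (level u 0) &
      level u 1 !=set0].

Record fuzzy (R : realType) (X : topologicalType) := Fuzzy {
  fuzzy_fun :> X -> R ;
  fuzzyP : is_fuzzy fuzzy_fun }.

Section distances.
Variables (R : realType) (X : metricType R).

(* Real sup and inf are 0 by convention on empty or unbounded sets; the ones below
   are taken over nonempty bounded sets when A and B are compact and nonempty and
   u and v are fuzzy sets. *)
Definition set_dist (x : X) (A : set X) : R := inf [set mdist x y | y in A].

Definition hausdorff_dist (A B : set X) : R :=
  Num.max (sup [set set_dist x B | x in A]) (sup [set set_dist x A | x in B]).

Definition supremum_dist (u v : X -> R) : R :=
  sup [set hausdorff_dist (level u a) (level v a) | a in `[0, 1]].

Definition increasing_homeo01 (xi : R -> R) : Prop :=
  {in `[0, 1] &, {homo xi : a b / a < b}} /\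
  exists eta : R -> R,
    [/\ set_fun `[0, 1] `[0, 1] xi /\ set_fun `[0, 1] `[0, 1] eta,
        {in `[0, 1], cancel xi eta}, {in `[0, 1], cancel eta xi},
        {within `[0, 1], continuous xi} & {within `[0, 1], continuous eta}].

Definition skorokhod_dist (u v : X -> R) : R :=
  inf [set e | exists xi : R -> R,
    [/\ increasing_homeo01 xi,
        sup [set `|xi a - a| | a in `[0, 1]] <= e &
        supremum_dist u (xi \o v) <= e]].

End distances.

Section fuzzy_theory.
Variables (R : realType) (X : topologicalType).
Implicit Types (u : X -> R) (a : R).

Lemma level0 u : level u 0 = closure [set x | 0 < u x].
Proof. by rewrite /level eqxx. Qed.

Lemma level_pos u a : 0 < a -> level u a = [set x | a <= u x].
Proof. by move=> a0; rewrite /level gt_eqF. Qed.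

Lemma level_sub0 u a : 0 <= a -> level u a `<=` level u 0.
Proof.
rewrite le_eqVlt => /predU1P[<-//|a0]; rewrite level0 level_pos //.
by move=> x /= ux; apply: subset_closure => /=; exact: lt_le_trans ux.
Qed.

Lemma closed_level u a : is_fuzzy u -> closed (level u a).
Proof.
move=> [_ usc _ _]; rewrite /level; case: ifP => _; first exact: closed_closure.
rewrite -openC openE => x /= /negP; rewrite -ltNge => /usc.
by apply: filterS => y ya; apply/negP; rewrite -ltNge.
Qed.

Lemma level_compact u a : is_fuzzy u -> 0 <= a -> compact (level u a).
Proof.
move=> fu a0; apply: (subclosed_compact (closed_level (a := a) fu)) (level_sub0 a0).
by case: fu.
Qed.

Lemma level_nonempty u a : is_fuzzy u -> 0 <= a <= 1 -> level u a !=set0.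
Proof.
move=> [_ _ _ [x]]; rewrite level_pos //= => ux /andP[a0 a1]; exists x.
move: a0; rewrite le_eqVlt => /predU1P[<-|a0].
  by rewrite level0; apply: subset_closure => /=; exact: lt_le_trans ux.
by rewrite level_pos //=; exact: le_trans ux.
Qed.

End fuzzy_theory.

Section hausdorff_dist_theory.
Variables (R : realType) (X : metricType R).
Implicit Types (A B C : set X) (e : R).

Lemma compact_mbounded (x : X) A : compact A ->
  exists M : R, forall y, A y -> mdist x y <= M.
Proof.
move=> /compact_near_coveringP cA.
have := cA R +oo (fun M y => mdist x y <= M).
case.
  move=> y Ay; exists (ball y 1, [set M | mdist x y + 1 <= M]).
    split => /=; first by apply: nbhsx_ballx; exact: ltr01.
    by apply: nbhs_pinfty_ge; exact: num_real.
  move=> [z M]/= [+ HM]; rewrite ballEmdist /= => yz.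
  apply: le_trans HM; apply: le_trans (metric_triangle _ y _) _.
  by rewrite lerD2l ltW.
move=> M [_ HM]; exists (M + 1) => y Ay.
by apply: (HM (M + 1)) => //; rewrite ltrDl.
Qed.

Lemma set_dist_le x A y : A y -> set_dist x A <= mdist x y.
Proof.
by move=> Ay; apply: ge_inf; [exists 0 => _ [z _ <-]; exact: mdist_ge0|exists y].
Qed.

Lemma set_dist_lt x A e : A !=set0 -> set_dist x A < e ->
  exists2 y, A y & mdist x y < e.
Proof.
move=> [a Aa] /inf_lt[|_ [y Ay <-] ye]; last by exists y.
by exists (mdist x a), a.
Qed.

Lemma set_dist_ge0 x A : A !=set0 -> 0 <= set_dist x A.
Proof.
move=> [y Ay]; apply: lb_le_inf => [|_ [z _ <-]]; last exact: mdist_ge0.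
by exists (mdist x y), y.
Qed.

Lemma set_dist_triangle x A B e : A !=set0 -> B !=set0 ->
  (forall y, A y -> set_dist y B <= e) -> set_dist x B <= set_dist x A + e.
Proof.
move=> A0 B0 AB; apply/ler_addgt0Pr => d d0.
have d20 : 0 < d / 2 by rewrite divr_gt0.
have [|y Ay xy] := @set_dist_lt x A (set_dist x A + d / 2) A0.
  by rewrite ltrDl.
have [|z Bz yz] := @set_dist_lt y B (e + d / 2) B0.
  by rewrite (le_lt_trans (AB _ Ay)) // ltrDl.
apply: (le_trans (set_dist_le x Bz)).
apply: (le_trans (metric_triangle _ y _)).
by rewrite (splitr d) addrACA lerD // ltW.
Qed.

Lemma set_dist_ubound A B : compact A -> B !=set0 ->
  has_ubound [set set_dist x B | x in A].
Proof.
move=> cA [b Bb]; have [M HM] := compact_mbounded b cA.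
exists M => _ [x Ax <-]; apply: le_trans (HM x Ax).
by rewrite metric_sym; exact: set_dist_le.
Qed.

Lemma hausdorff_dist_leP A B e :
  compact A -> A !=set0 -> compact B -> B !=set0 ->
  hausdorff_dist A B <= e <->
  (forall x, A x -> set_dist x B <= e) /\ (forall x, B x -> set_dist x A <= e).
Proof.
move=> cA A0 cB B0; rewrite /hausdorff_dist ge_max; split.
  move=> /andP[AB BA]; split=> x Cx.
    apply: le_trans AB; apply: ub_le_sup; first exact: set_dist_ubound.
    by exists x.
  apply: le_trans BA; apply: ub_le_sup; first exact: set_dist_ubound.
  by exists x.
move=> [AB BA]; apply/andP; split; apply: ge_sup.
- by have [x Ax] := A0; exists (set_dist x B), x.
- by move=> _ [x Ax <-]; exact: AB.
- by have [x Bx] := B0; exists (set_dist x A), x.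
- by move=> _ [x Bx <-]; exact: BA.
Qed.

Lemma hausdorff_dist_ge0 A B :
  compact A -> A !=set0 -> compact B -> B !=set0 -> 0 <= hausdorff_dist A B.
Proof.
move=> cA A0 cB B0; have [x Ax] := A0.
have [AB _] := (hausdorff_dist_leP (hausdorff_dist A B) cA A0 cB B0).1 (lexx _).
exact: le_trans (set_dist_ge0 x B0) (AB _ Ax).
Qed.

Lemma hausdorff_dist_sym A B : hausdorff_dist A B = hausdorff_dist B A.
Proof. by rewrite /hausdorff_dist maxC. Qed.

Lemma hausdorff_distxx A : compact A -> A !=set0 -> hausdorff_dist A A = 0.
Proof.
move=> cA A0; apply/eqP; rewrite eq_le hausdorff_dist_ge0 // andbT.
have H x : A x -> set_dist x A <= 0.
  by move=> Ax; rewrite -(mdistxx x); exact: set_dist_le.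
exact/hausdorff_dist_leP.
Qed.

Lemma hausdorff_dist_triangle A B C :
  compact A -> A !=set0 -> compact B -> B !=set0 -> compact C -> C !=set0 ->
  hausdorff_dist A C <= hausdorff_dist A B + hausdorff_dist B C.
Proof.
move=> cA A0 cB B0 cC C0.
have [AB BA] := (hausdorff_dist_leP _ cA A0 cB B0).1 (lexx _).
have [BC CB] := (hausdorff_dist_leP _ cB B0 cC C0).1 (lexx _).
apply/hausdorff_dist_leP => //; split=> x Hx.
  apply: (le_trans (set_dist_triangle x B0 C0 BC)).
  by rewrite lerD2r; exact: AB.
apply: (le_trans (set_dist_triangle x B0 A0 BA)).
by rewrite addrC lerD2l; exact: CB.
Qed.

End hausdorff_dist_theory.

Section supremum_dist_theory.
Variables (R : realType) (X : metricType R).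
Implicit Types (u v w : X -> R) (e : R).

Lemma hausdorff_level_ubound u v : is_fuzzy u -> is_fuzzy v ->
  has_ubound [set hausdorff_dist (level u a) (level v a) | a in `[0, 1]].
Proof.
move=> fu fv.
have [x ux] : level u 0 !=set0 by apply: level_nonempty => //; rewrite lexx ler01.
have [M HM] := compact_mbounded x (level_compact fu (lexx 0)).
have [N HN] := compact_mbounded x (level_compact fv (lexx 0)).
exists (M + N) => _ [a /= + <-]; rewrite in_itv /= => a01.
have /andP[a0 a1] := a01.
have u0 := level_nonempty fu a01; have v0 := level_nonempty fv a01.
have cu := level_compact fu a0; have cv := level_compact fv a0.
have H y z : level u a y -> level v a z -> mdist y z <= M + N.
  move=> /(level_sub0 a0)/HM xy /(level_sub0 a0)/HN xz.
  by rewrite (le_trans (metric_triangle _ x _)) // metric_sym lerD.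
apply/hausdorff_dist_leP => //; split=> y Hy.
  by have [z Hz] := v0; apply: le_trans (set_dist_le y Hz) _; exact: H.
have [z Hz] := u0; apply: le_trans (set_dist_le y Hz) _.
by rewrite metric_sym; exact: H.
Qed.

Lemma supremum_dist_leP u v e : is_fuzzy u -> is_fuzzy v ->
  supremum_dist u v <= e <->
  forall a, 0 <= a <= 1 -> hausdorff_dist (level u a) (level v a) <= e.
Proof.
move=> fu fv; split=> [H a a01|H].
  apply: le_trans H; apply: ub_le_sup; first exact: hausdorff_level_ubound.
  by exists a => //=; rewrite in_itv.
apply: ge_sup => [|_ [a /= + <-]]; last by rewrite in_itv /=; exact: H.
exists (hausdorff_dist (level u 0) (level v 0)), 0 => //=.
by rewrite in_itv /= lexx ler01.
Qed.

Lemma supremum_dist_ge0 u v : is_fuzzy u -> is_fuzzy v -> 0 <= supremum_dist u v.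
Proof.
move=> fu fv; have H01 : 0 <= (1 : R) <= 1 by rewrite lexx ler01.
have := (supremum_dist_leP (supremum_dist u v) fu fv).1 (lexx _) _ H01.
apply: le_trans; apply: hausdorff_dist_ge0;
  by [apply: level_compact|apply: level_nonempty].
Qed.

Lemma supremum_dist_sym u v : supremum_dist u v = supremum_dist v u.
Proof.
by congr sup; apply: eq_imagel => a _; rewrite hausdorff_dist_sym.
Qed.

Lemma supremum_distxx u : is_fuzzy u -> supremum_dist u u = 0.
Proof.
move=> fu; apply/eqP; rewrite eq_le supremum_dist_ge0 // andbT.
apply/supremum_dist_leP => // a /[dup] a01 /andP[a0 _].
by rewrite hausdorff_distxx //; [exact: level_compact|exact: level_nonempty].
Qed.

Lemma supremum_dist_triangle u v w : is_fuzzy u -> is_fuzzy v -> is_fuzzy w ->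
  supremum_dist u w <= supremum_dist u v + supremum_dist v w.
Proof.
move=> fu fv fw; apply/supremum_dist_leP => // a /[dup] a01 /andP[a0 _].
have H (t : X -> R) : is_fuzzy t -> compact (level t a) /\ level t a !=set0.
  by move=> ft; split; [exact: level_compact|exact: level_nonempty].
have [[[cu u0] [cv v0]] [cw w0]] := (H _ fu, H _ fv, H _ fw).
apply: (le_trans (hausdorff_dist_triangle cu u0 cv v0 cw w0)).
by apply: lerD; apply: (supremum_dist_leP _ _ _).1 (lexx _) _ a01.
Qed.

End supremum_dist_theory.

Section increasing_homeo01_theory.
Variable R : realType.
Implicit Types xi eta : R -> R.

Lemma increasing_homeo01_bijP xi eta :
  {in `[0, 1] &, {homo xi : a b / a < b}} ->
  set_fun `[0, 1] `[0, 1] xi -> set_fun `[0, 1] `[0, 1] eta ->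
  {in `[0, 1], cancel eta xi} ->
  [/\ {in `[0, 1] &, {mono xi : a b / a <= b}},
      {in `[0, 1] &, {mono eta : a b / a <= b}},
      xi 0 = 0 /\ xi 1 = 1 & eta 0 = 0 /\ eta 1 = 1].
Proof.
move=> xi_incr sxi seta etaK.
have m := le_mono_in xi_incr.
have fxi a : a \in `[0, 1] -> xi a \in `[0, 1] by exact: sxi.
have feta a : a \in `[0, 1] -> eta a \in `[0, 1] by exact: seta.
have m' : {in `[0, 1] &, {mono eta : a b / a <= b}}.
  by move=> a b a01 b01; rewrite -m ?feta // !etaK.
have i0 : (0 : R) \in `[0, 1] by rewrite in_itv /= lexx ler01.
have i1 : (1 : R) \in `[0, 1] by rewrite in_itv /= lexx ler01.
split => //; split; apply/eqP; rewrite eq_le.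
- have := fxi _ i0; rewrite in_itv /= => /andP[-> _]; rewrite andbT.
  rewrite -{2}(etaK 0) // m ?feta //.
  by have := feta _ i0; rewrite in_itv /= => /andP[].
- have := fxi _ i1; rewrite in_itv /= => /andP[_ ->] /=.
  rewrite -{1}(etaK 1) // m ?feta //.
  by have := feta _ i1; rewrite in_itv /= => /andP[].
- have := feta _ i0; rewrite in_itv /= => /andP[-> _]; rewrite andbT.
  rewrite -m ?feta // etaK //.
  by have := fxi _ i0; rewrite in_itv /= => /andP[].
- have := feta _ i1; rewrite in_itv /= => /andP[_ ->] /=.
  rewrite -m ?feta // etaK //.
  by have := fxi _ i1; rewrite in_itv /= => /andP[].
Qed.

(* Continuity is automatic for an increasing bijection of [0, 1]. *)
Lemma increasing_homeo01_build xi eta :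
  {in `[0, 1] &, {homo xi : a b / a < b}} ->
  set_fun `[0, 1] `[0, 1] xi -> set_fun `[0, 1] `[0, 1] eta ->
  {in `[0, 1], cancel xi eta} -> {in `[0, 1], cancel eta xi} ->
  increasing_homeo01 xi.
Proof.
move=> xi_incr sxi seta xiK etaK.
have [m m' [x0 x1] [e0 e1]] := increasing_homeo01_bijP xi_incr sxi seta etaK.
split => //; exists eta; split => //.
  apply: segment_inc_surj_continuous => //.
  rewrite x0 x1 => a a01; exists (eta a); first exact: seta.
  exact: etaK.
apply: segment_inc_surj_continuous => //.
rewrite e0 e1 => a a01; exists (xi a); first exact: sxi.
exact: xiK.
Qed.

Lemma increasing_homeo01_id : increasing_homeo01 (id : R -> R).
Proof. by apply: (@increasing_homeo01_build _ id). Qed.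

Lemma increasing_homeo01_comp xi1 xi2 :
  increasing_homeo01 xi1 -> increasing_homeo01 xi2 ->
  increasing_homeo01 (xi1 \o xi2).
Proof.
move=> [h1 [eta1 [[s1 t1] K1 L1 _ _]]] [h2 [eta2 [[s2 t2] K2 L2 _ _]]].
apply: (@increasing_homeo01_build _ (eta2 \o eta1)).
- by move=> a b a01 b01 ab /=; apply: h1; [exact: s2|exact: s2|exact: h2].
- by move=> a a01; apply: s1; exact: s2.
- by move=> a a01; apply: t2; exact: t1.
- by move=> a a01 /=; rewrite K1 ?K2 //; exact: s2.
- by move=> a a01 /=; rewrite L2 ?L1 //; exact: t1.
Qed.

Lemma increasing_homeo01_dist_leP xi (e : R) : set_fun `[0, 1] `[0, 1] xi ->
  sup [set `|xi a - a| | a in `[0, 1]] <= e <->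
  forall a, 0 <= a <= 1 -> `|xi a - a| <= e.
Proof.
move=> sxi; split=> [H a a01|H].
  apply: le_trans H; apply: ub_le_sup; last by exists a => //=; rewrite in_itv.
  exists 1 => _ [b /= b01 <-]; have := sxi b b01; move: b01 => /=.
  rewrite !in_itv /= => /andP[b0 b1] /andP[x0 x1]; rewrite ler_distl.
  by rewrite lerBlDr (le_trans x1) ?lerDr // (le_trans b1) // lerDr.
apply: ge_sup => [|_ [a /= + <-]]; last by rewrite in_itv /=; exact: H.
by exists `|xi 0 - 0|, 0 => //=; rewrite in_itv /= lexx ler01.
Qed.

End increasing_homeo01_theory.

Section skorokhod_dist_theory.
Variables (R : realType) (X : metricType R).
Implicit Types (u v w : X -> R) (xi eta : R -> R).

Lemma increasing_homeo01_inv xi : increasing_homeo01 xi ->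
  exists eta : R -> R,
    [/\ increasing_homeo01 eta, set_fun `[0, 1] `[0, 1] xi,
        set_fun `[0, 1] `[0, 1] eta,
        {in `[0, 1], cancel xi eta} & {in `[0, 1], cancel eta xi}].
Proof.
move=> [h [eta [[s t] K L _ _]]]; exists eta; split => //.
have [_ m' _ _] := increasing_homeo01_bijP h s t L.
apply: (@increasing_homeo01_build _ _ xi) => //.
by move=> a b a01 b01 ab; rewrite (leW_mono_in m').
Qed.

Lemma level_comp xi eta v a :
  {in `[0, 1] &, {homo xi : a b / a < b}} ->
  set_fun `[0, 1] `[0, 1] xi -> set_fun `[0, 1] `[0, 1] eta ->
  {in `[0, 1], cancel eta xi} ->
  (forall x, 0 <= v x <= 1) -> 0 <= a <= 1 ->
  level (xi \o v) a = level v (eta a).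
Proof.
move=> h s t L v01 a01.
have [m m' [x0 x1] [e0 e1]] := increasing_homeo01_bijP h s t L.
have i0 : (0 : R) \in `[0, 1] by rewrite in_itv /= lexx ler01.
have vi x : v x \in `[0, 1] by rewrite in_itv /=.
have ai : a \in `[0, 1] by rewrite in_itv.
have := a01 => /andP[]; rewrite le_eqVlt => /predU1P[<- _|a0 _].
  rewrite e0 !level0; congr closure; apply/seteqP.
  have E x : (0 < xi (v x)) = (0 < v x).
    by rewrite -[in LHS]x0 (leW_mono_in m).
  by split=> x /=; rewrite E.
have ea0 : 0 < eta a by rewrite -[ltLHS]e0 (leW_mono_in m').
rewrite !level_pos //; apply/seteqP.
have E x : (a <= xi (v x)) = (eta a <= v x).
  by rewrite -{1}(L a) // m //; exact: t.
by split=> x /=; rewrite E.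
Qed.

Lemma is_fuzzy_comp xi v : increasing_homeo01 xi -> is_fuzzy v ->
  is_fuzzy (xi \o v).
Proof.
move=> [h [eta [[s t] K L _ _]]] [v01 usc cv v1].
have [m m' [x0 x1] [e0 e1]] := increasing_homeo01_bijP h s t L.
have vi x : v x \in `[0, 1] by rewrite in_itv /=.
have xi01 x : 0 <= xi (v x) <= 1.
  by have := s _ (vi x); rewrite /= in_itv.
have H01 : 0 <= (1 : R) <= 1 by rewrite lexx ler01.
have H00 : 0 <= (0 : R) <= 1 by rewrite lexx ler01.
split => //.
- move=> x a /= xa.
  have [a1|a1] := ltP 1 a.
    by apply: nearW => y; apply: le_lt_trans a1; have /andP[] := xi01 y.
  have ai : a \in `[0, 1].
    rewrite in_itv /= a1 andbT; apply: le_trans (ltW xa).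
    by have /andP[] := xi01 x.
  have ta : eta a \in `[0, 1] := t _ ai.
  have E y : (xi (v y) < a) = (v y < eta a).
    by rewrite -{1}(L a) // (leW_mono_in m).
  by move: xa; rewrite E => /usc; apply: filterS => y; rewrite E.
- by rewrite (level_comp (eta := eta)) // e0.
- by rewrite (level_comp (eta := eta)) // e1.
Qed.

Lemma supremum_dist_comp xi u v : increasing_homeo01 xi ->
  is_fuzzy u -> is_fuzzy v ->
  supremum_dist (xi \o u) (xi \o v) <= supremum_dist u v.
Proof.
move=> hxi fu fv; apply/supremum_dist_leP; [exact: is_fuzzy_comp..|].
move=> a a01; have [h [eta [[s t] K L _ _]]] := hxi.
have [u01 _ _ _] := fu; have [v01 _ _ _] := fv.
rewrite !(level_comp (eta := eta)) //.
apply: (supremum_dist_leP _ _ _).1 (lexx _) _ _ => //.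
have : eta a \in `[0, 1] by apply: t; rewrite /= in_itv.
by rewrite in_itv.
Qed.

Let skorokhod_set u v : set R := [set e | exists xi : R -> R,
  [/\ increasing_homeo01 xi,
      sup [set `|xi a - a| | a in `[0, 1]] <= e &
      supremum_dist u (xi \o v) <= e]].

Let skorokhod_set_lbound u v : is_fuzzy u -> is_fuzzy v ->
  lbound (skorokhod_set u v) 0.
Proof.
move=> fu fv e [xi [hxi _ +]]; apply: le_trans; apply: supremum_dist_ge0 => //.
exact: is_fuzzy_comp.
Qed.

Let skorokhod_set_nonempty u v : is_fuzzy u -> is_fuzzy v ->
  skorokhod_set u v (supremum_dist u v).
Proof.
move=> fu fv; exists id; split => //; first exact: increasing_homeo01_id.
apply/increasing_homeo01_dist_leP => // a _.
by rewrite subrr normr0 supremum_dist_ge0.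
Qed.

Lemma skorokhod_dist_le u v e xi : is_fuzzy u -> is_fuzzy v ->
  increasing_homeo01 xi -> (forall a, 0 <= a <= 1 -> `|xi a - a| <= e) ->
  supremum_dist u (xi \o v) <= e -> skorokhod_dist u v <= e.
Proof.
move=> fu fv hxi He uv; apply: ge_inf.
  by exists 0; exact: skorokhod_set_lbound.
exists xi; split => //; apply/increasing_homeo01_dist_leP => //.
by have [eta []] := increasing_homeo01_inv hxi.
Qed.

Lemma skorokhod_dist_lt u v e : is_fuzzy u -> is_fuzzy v ->
  skorokhod_dist u v < e -> exists xi e', [/\ increasing_homeo01 xi, e' < e,
    forall a, 0 <= a <= 1 -> `|xi a - a| <= e' & supremum_dist u (xi \o v) <= e'].
Proof.
move=> fu fv /inf_lt[|e' [xi [hxi He uv] e'e]].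
  by exists (supremum_dist u v); exact: skorokhod_set_nonempty.
exists xi, e'; split => //; apply/increasing_homeo01_dist_leP => //.
by have [eta []] := increasing_homeo01_inv hxi.
Qed.

Lemma skorokhod_distxx u : is_fuzzy u -> skorokhod_dist u u = 0.
Proof.
move=> fu; apply/eqP; rewrite eq_le; apply/andP; split.
  apply: (@skorokhod_dist_le _ _ _ id) => //; first exact: increasing_homeo01_id.
    by move=> a _; rewrite subrr normr0.
  by rewrite [_ \o _](_ : _ = u) // supremum_distxx.
apply: lb_le_inf; last exact: skorokhod_set_lbound.
by exists (supremum_dist u u); exact: skorokhod_set_nonempty.
Qed.

Lemma skorokhod_dist_sym_le u v : is_fuzzy u -> is_fuzzy v ->
  skorokhod_dist v u <= skorokhod_dist u v.
Proof.
move=> fu fv; apply/ler_addgt0Pr => d d0.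
have [|xi [e [hxi ed He uv]]] := @skorokhod_dist_lt u v (skorokhod_dist u v + d) fu fv.
  by rewrite ltrDl.
apply: le_trans (ltW ed).
have [eta [heta s t K L]] := increasing_homeo01_inv hxi.
apply: (@skorokhod_dist_le _ _ _ eta) => //.
  move=> a a01; have ea : eta a \in `[0, 1] by apply: t; rewrite /= in_itv.
  have ai : a \in `[0, 1] by rewrite in_itv.
  by rewrite -{2}(L a) // distrC He //; move: ea; rewrite in_itv.
have -> : v = eta \o (xi \o v).
  apply/funext => x /=; rewrite K // in_itv /=.
  by have [v01 _ _ _] := fv; exact: v01.
apply: (le_trans (supremum_dist_comp heta _ fu)); first exact: is_fuzzy_comp.
by rewrite supremum_dist_sym.
Qed.

Lemma skorokhod_dist_sym u v : is_fuzzy u -> is_fuzzy v ->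
  skorokhod_dist u v = skorokhod_dist v u.
Proof.
by move=> fu fv; apply/eqP; rewrite eq_le !skorokhod_dist_sym_le.
Qed.

Lemma skorokhod_dist_triangle u v w : is_fuzzy u -> is_fuzzy v -> is_fuzzy w ->
  skorokhod_dist u w <= skorokhod_dist u v + skorokhod_dist v w.
Proof.
move=> fu fv fw; apply/ler_addgt0Pr => d d0.
have d20 : 0 < d / 2 by rewrite divr_gt0.
have [|xi1 [e1 [h1 ed1 He1 uv]]] :=
  @skorokhod_dist_lt u v (skorokhod_dist u v + d / 2) fu fv.
  by rewrite ltrDl.
have [|xi2 [e2 [h2 ed2 He2 vw]]] :=
  @skorokhod_dist_lt v w (skorokhod_dist v w + d / 2) fv fw.
  by rewrite ltrDl.
apply: (@le_trans _ _ (e1 + e2)); last by rewrite (splitr d) addrACA lerD // ltW.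
apply: (@skorokhod_dist_le _ _ _ (xi1 \o xi2)) => //.
- exact: increasing_homeo01_comp.
- move=> a a01 /=; apply: (le_trans (ler_distD (xi2 a) _ _)).
  apply: lerD; last exact: He2.
  apply: He1; have [eta2 [_ s2 _ _ _]] := increasing_homeo01_inv h2.
  by have := s2 a; rewrite /= !in_itv /=; exact.
- have f2 := is_fuzzy_comp h2 fw.
  apply: (le_trans (supremum_dist_triangle fu (is_fuzzy_comp h1 fv) _)).
    exact: (is_fuzzy_comp h1 f2).
  apply: lerD => //; apply: le_trans vw; exact: supremum_dist_comp.
Qed.

Lemma skorokhod_dist0_le u v x : is_fuzzy u -> is_fuzzy v ->
  skorokhod_dist u v = 0 -> u x <= v x.
Proof.
move=> fu fv uv0; rewrite leNgt; apply/negP => vu.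
have [u01 _ _ _] := fu; have [v01 usc _ _] := fv.
pose b := (v x + u x) / 2.
have vb : v x < b by rewrite /b midf_lt.
have bu : b < u x by rewrite /b midf_lt.
have /nbhs_ballP[r /= r0 Hr] := usc _ _ vb.
have e0 : 0 < Num.min r (u x - b) by rewrite lt_min r0 subr_gt0.
have [|xi [e [hxi + He uv]]] := @skorokhod_dist_lt u v (Num.min r (u x - b)) fu fv.
  by rewrite uv0.
rewrite lt_min => /andP[er eb].
have fxv := is_fuzzy_comp hxi fv.
have ux0 : 0 < u x by apply: le_lt_trans vu; have /andP[] := v01 x.
have /(supremum_dist_leP _ fu fxv) /(_ _ (u01 x)) := uv.
have L := level_nonempty fxv (u01 x).
move=> /hausdorff_dist_leP [].
- exact: level_compact (ltW ux0).
- exact: level_nonempty.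
- exact: level_compact (ltW ux0).
- exact: level_nonempty.
have ulx : level u (u x) x by rewrite level_pos /=.
move=> /(_ _ ulx) /le_lt_trans /(_ er) /(set_dist_lt L)[y + xy] _.
rewrite level_pos //= => uxi.
have vyb : v y < b by apply: Hr; rewrite ballEmdist.
have := He _ (v01 y); rewrite leNgt => /negP; apply.
apply: (lt_le_trans eb); apply: le_trans (ler_norm _).
by apply: lerB => //; exact: ltW.
Qed.

End skorokhod_dist_theory.

Section fuzzy_spaces.
Variables (R : realType) (X : metricType R).

Lemma fuzzy_eq (u v : fuzzy R X) : (forall x, u x = v x) -> u = v.
Proof.
case: u v => [u fu] [v fv] /= /funext uv; subst v.
by congr Fuzzy; exact: Prop_irrelevance.
Qed.

Lemma supremum_dist_positivity (u v : fuzzy R X) :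
  supremum_dist u v = 0 -> u = v.
Proof.
have [fu fv] := (fuzzyP u, fuzzyP v).
have H (s t : X -> R) : is_fuzzy s -> is_fuzzy t -> supremum_dist s t = 0 ->
    forall x, s x <= t x.
  move=> fs ft st x; apply: skorokhod_dist0_le => //.
  apply/eqP; rewrite eq_le; apply/andP; split.
    apply: (@skorokhod_dist_le _ _ _ _ _ id) => //.
    - exact: increasing_homeo01_id.
    - by move=> a _; rewrite subrr normr0.
    - by rewrite [_ \o _](_ : _ = t) // st.
  have := skorokhod_dist_triangle fs ft fs.
  rewrite skorokhod_distxx // (skorokhod_dist_sym ft fs).
  by rewrite -mulr2n pmulrn_lge0.
move=> uv; apply: fuzzy_eq => x; apply/eqP; rewrite eq_le !H //.
by rewrite supremum_dist_sym.
Qed.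

Lemma skorokhod_dist_positivity (u v : fuzzy R X) :
  skorokhod_dist u v = 0 -> u = v.
Proof.
have [fu fv] := (fuzzyP u, fuzzyP v).
move=> uv; apply: fuzzy_eq => x; apply/eqP.
by rewrite eq_le !skorokhod_dist0_le // skorokhod_dist_sym.
Qed.

End fuzzy_spaces.

Definition fuzzy_supremum (R : realType) (X : metricType R) : Type := fuzzy R X.
Definition fuzzy_skorokhod (R : realType) (X : metricType R) : Type := fuzzy R X.

Section fuzzy_metrics.
Variables (R : realType) (X : metricType R).

HB.instance Definition _ := gen_eqMixin (fuzzy_supremum X).
HB.instance Definition _ := gen_choiceMixin (fuzzy_supremum X).
HB.instance Definition _ := gen_eqMixin (fuzzy_skorokhod X).
HB.instance Definition _ := gen_choiceMixin (fuzzy_skorokhod X).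

HB.instance Definition _ := @isMetric.Build R (fuzzy_supremum X)
  (fun u v : fuzzy R X => supremum_dist u v)
  (fun u => supremum_distxx (fuzzyP u))
  (@supremum_dist_positivity R X)
  (fun u v => @supremum_dist_sym R X (fuzzy_fun u) (fuzzy_fun v))
  (fun v u w => supremum_dist_triangle (fuzzyP u) (fuzzyP v) (fuzzyP w)).

HB.instance Definition _ := @isMetric.Build R (fuzzy_skorokhod X)
  (fun u v : fuzzy R X => skorokhod_dist u v)
  (fun u => skorokhod_distxx (fuzzyP u))
  (@skorokhod_dist_positivity R X)
  (fun u v => skorokhod_dist_sym (fuzzyP u) (fuzzyP v))
  (fun v u w => skorokhod_dist_triangle (fuzzyP u) (fuzzyP v) (fuzzyP w)).

End fuzzy_metrics.

Definition zadeh (R : realType) (X : Type) (f : X -> X) (u : X -> R) (x : X) : R :=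
  if pselect (exists y, f y = x) then sup [set u y | y in f @^-1` [set x]] else 0.

Section zadeh_map.
Variables (R : realType) (X : metricType R) (f : X -> X).
Hypothesis cf : continuous f.

Lemma zadeh_ge0_le1 (u : X -> R) x : (forall y, 0 <= u y <= 1) ->
  0 <= zadeh f u x <= 1.
Proof.
move=> u01; rewrite /zadeh; case: pselect => [[y fy]|?]; last by rewrite lexx ler01.
have ub : ubound [set u z | z in f @^-1` [set x]] 1.
  by move=> _ [z _ <-]; have /andP[] := u01 z.
apply/andP; split; last by apply: ge_sup => //; exists (u y), y.
apply: (@le_trans _ _ (u y)); first by have /andP[] := u01 y.
by apply: ub_le_sup; [exists 1|exists y].
Qed.

Lemma le_zadehP (u : X -> R) x a : is_fuzzy u -> 0 < a ->
  a <= zadeh f u x <-> exists2 y, f y = x & a <= u y.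
Proof.
move=> fu a0; have [u01 usc _ _] := fu; split; last first.
  move=> [y fy ay]; rewrite /zadeh; case: pselect => [?|]; last by case; exists y.
  apply: le_trans ay _; apply: ub_le_sup; last by exists y.
  by exists 1 => _ [z _ <-]; have /andP[] := u01 z.
rewrite /zadeh; case: pselect => [[z fz]|?]; last by rewrite leNgt a0.
move=> asup; apply: contrapT => noy.
have cl : closed (f @^-1` [set x]).
  apply: closed_comp => [y _|]; first exact: cf.
  exact/accessible_closed_set1/hausdorff_accessible/metric_hausdorff.
have a20 : 0 < a / 2 by rewrite divr_gt0.
pose K := f @^-1` [set x] `&` level u (a / 2).
have cK : compact K.
  apply: (subclosed_compact _ (level_compact fu (ltW a20))); last by move=> y [].
  by apply: closedI => //; exact: closed_level.
have := (compact_near_coveringP _).1 cK R (at_left a) (fun b y => u y < b) _.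
case.
  move=> y [fy _].
  have uya : u y < a by rewrite ltNge; apply/negP => ?; apply: noy; exists y.
  pose b := (u y + a) / 2.
  have ub : u y < b by rewrite /b midf_lt.
  have ba : b < a by rewrite /b midf_lt.
  exists ([set t | u t < b], [set c | b <= c]).
    by split => /=; [exact: usc|exact: nbhs_left_ge].
  by move=> [t c] /= [+ bc]; move=> /lt_le_trans; exact.
move=> d /= d0 Hd.
pose c := Num.max (a / 2) (a - d / 2).
have ca : c < a.
  by rewrite /c gt_max ltr_pdivrMr // ltr_pMr // ltr1n /= gtrBl divr_gt0.
have Kc : K `<=` (fun y => u y < c).
  apply: Hd => //=; rewrite ger0_norm; last by rewrite subr_ge0 ltW.
  rewrite ltrBlDr -ltrBlDl; apply: (@lt_le_trans _ _ (a - d / 2)).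
    by rewrite ltrD2l ltrN2 ltr_pdivrMr // ltr_pMr // ltr1n.
  by rewrite /c le_max lexx orbT.
move: asup; rewrite leNgt => /negP; apply; apply: le_lt_trans ca.
apply: ge_sup; first by exists (u z), z.
move=> _ [y fy <-]; have [uy|uy] := leP (a / 2) (u y).
  by apply/ltW/Kc; split => //; rewrite level_pos.
by rewrite /c le_max (ltW uy).
Qed.

Lemma is_fuzzy_zadeh (u : X -> R) : is_fuzzy u -> is_fuzzy (zadeh f u).
Proof.
move=> fu; have [u01 usc cu [x1 ux1]] := fu.
have hX := @metric_hausdorff R X.
have cfK (K : set X) : compact K -> compact (f @` K).
  by apply: continuous_compact; exact: continuous_subspaceT.
have cfC a : 0 <= a -> closed (f @` level u a).
  by move=> a0; apply: compact_closed => //; apply: cfK; exact: level_compact.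
split.
- by move=> x; exact: zadeh_ge0_le1.
- move=> x a xa.
  have a0 : 0 < a by apply: le_lt_trans xa; have /andP[] := zadeh_ge0_le1 x u01.
  have E y : ~ (f @` level u a) y <-> zadeh f u y < a.
    rewrite ltNge level_pos //; split=> [H|/negP H [z /= az fz]].
      by apply/negP => /le_zadehP []// z fz az; apply: H; exists z.
    by apply: H; apply/le_zadehP => //; exists z.
  have oC : open (~` (f @` level u a)) by rewrite openC; exact/cfC/ltW.
  have : nbhs x (~` (f @` level u a)) by apply: open_nbhs_nbhs; split => //; exact/E.
  by apply: filterS => y /E.
- apply: (subclosed_compact _ (cfK _ cu)); first by rewrite level0; exact: closed_closure.
  rewrite level0 [X in _ `<=` X](closure_id _).1; last exact: cfC.
  apply: closure_subset => x /= x0.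
  have [//|y fy uy] := (le_zadehP x fu x0).1.
  exists y => //; rewrite level0; apply: subset_closure => /=.
  exact: lt_le_trans uy.
- exists (f x1); rewrite level_pos //=; apply/le_zadehP => //; exists x1 => //.
  by move: ux1; rewrite level_pos.
Qed.

Definition zadeh_map (u : fuzzy R X) : fuzzy R X :=
  Fuzzy (is_fuzzy_zadeh (fuzzyP u)).

End zadeh_map.

(* Main.v *)
(** Quasi-rigidity of any of the four systems yields times n_k such that every
    nonempty open U contains a point x with f^(n_k)(x) in U for all large k: take
    x in a compact set K (resp. in the top level of a fuzzy set) inside U which
    belongs to the dense set of points returning along (n_k).  Conversely, on a
    separable complete space, nested balls started near each point of a countable
    dense set produce, by a diagonal choice of times, a dense set of points all
    returning along one subsequence.  From there, the finite subsets of that dense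
    set are dense in K(X), and the fuzzy sets supported on such finite subsets are
    dense for d_infty; both kinds return along the same times. *)

Require Import Defs.
From HB Require Import structures.
From mathcomp Require Import all_boot all_order all_algebra finmap.
From mathcomp Require Import all_classical all_reals.
From mathcomp Require Import topology normedtype.

Set Implicit Arguments.
Unset Strict Implicit.
Unset Printing Implicit Defensive.

Import Order.TTheory GRing.Theory Num.Theory.
Import numFieldNormedType.Exports.

Local Open Scope classical_set_scope.
Local Open Scope ring_scope.

(** * Returns along a common time sequence *)

(** The times serve all [U] at once, while [x] may vary with [U] and only has to come back to [U],
    not converge to itself. *)
Definition eventually_returning (Y : topologicalType) (g : Y -> Y) : Prop :=
  exists n : nat -> nat,
    [/\ forall k, (0 < n k)%N, {homo n : i j / (i < j)%N} &
      forall U : set Y, open U -> U !=set0 ->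
        exists2 x, U x & \forall k \near \oo, U (iter (n k) g x)].

Lemma homo_ltn_ge (n : nat -> nat) k :
  {homo n : i j / (i < j)%N} -> (k <= n k)%N.
Proof.
move=> hn; elim: k => // k IH; exact: leq_ltn_trans IH (hn _ _ (ltnSn k)).
Qed.

Lemma countable_range (T : Type) (D : set T) : countable D -> D !=set0 ->
  exists e : nat -> T, D = range e.
Proof.
move=> cD [d Dd].
have [g ginj] : exists g : T -> nat, {in D &, injective g}.
  by have /countable_injP[g] := cD; exists g.
have /choice[e He] : forall i, exists y, D y /\
    ((exists2 x, D x & g x = i) -> g y = i).
  move=> i; have [[x Dx gx]|nx] := pselect (exists2 x, D x & g x = i).
    by exists x.
  by exists d; split => // /nx.
exists e; apply/seteqP; split=> [x Dx|_ [i _ <-]]; last by have [] := He i.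
have [De ge] := He (g x); exists (g x) => //.
by apply: ginj; rewrite ?inE //; apply: ge; exists x.
Qed.

(** * Nested balls and the diagonal choice of times *)

Section nested_returns.
Variables (R : realType) (X : metricType R).

Lemma open_mdist_lt (c : X) (r : R) : open [set y | mdist c y < r].
Proof.
rewrite openE => x /= cx; apply/nbhs_ballP.
exists (r - mdist c x); first by rewrite /= subr_gt0.
move=> y; rewrite ballEmdist /= ltrBrDl; apply: le_lt_trans.
exact: metric_triangle.
Qed.

Lemma mdist_le_in_nbhs (x : X) (W : set X) (r : R) : nbhs x W -> 0 < r ->
  exists e : R, [/\ 0 < e, e <= r & forall y, mdist x y <= e -> W y].
Proof.
move=> /nbhs_ballP[e /= e0 eW] r0; exists (Num.min (e / 2) r); split.
- by rewrite lt_min r0 divr_gt0.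
- by rewrite ge_min lexx orbT.
- move=> y; rewrite le_min => /andP[xy _]; apply: eW.
  rewrite ballEmdist /=; apply: le_lt_trans xy _.
  by rewrite ltr_pdivrMr // ltr_pMr // ltr1n.
Qed.

(** Nesting puts all later centres in the closed ball of index [k], so the centres are Cauchy and
    their limit lies in every closed ball. *)
Lemma nested_balls (c : nat -> X) (r : nat -> R) : complete_space X ->
  (forall e, 0 < e -> exists k, r k < e) ->
  (forall k y, mdist (c k.+1) y <= r k.+1 -> mdist (c k) y < r k) ->
  (forall k, 0 < r k) ->
  exists z, forall k, mdist (c k) z < r k.
Proof.
move=> complX rlim nest r0.
have nestD k i y : mdist (c (k + i)%N) y <= r (k + i)%N -> mdist (c k) y <= r k.
  elim: i => [|i IH]; first by rewrite addn0.
  by rewrite addnS => /nest /ltW /IH.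
have mem k i : (k <= i)%N -> mdist (c k) (c i) <= r k.
  move=> ki; apply: (@nestD _ (i - k)%N); rewrite subnKC // mdistxx.
  exact: ltW.
have [|z cz] := complX c.
  apply: cauchy_exP => e e0; have [k rk] := rlim _ e0.
  exists (c k); exists k => // i /= ki; rewrite ballEmdist /=.
  exact: le_lt_trans (mem _ _ ki) rk.
(* The limit is placed in the closed ball of index [k.+1]; nesting then gives the strict bound at
   [k]. *)
exists z => k; apply: nest; apply/ler_addgt0Pr => e e0.
have /metricType_numDomainType.cvgr_dist_lt /(_ _ e0) [N _ HN] := cz.
have := HN (maxn N k.+1) (leq_maxl _ _) => /= zc.
apply: le_trans (metric_triangle _ (c (maxn N k.+1)) _) _.
by rewrite lerD // ?mem ?leq_maxr // metric_sym ltW.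
Qed.

Variable f : X -> X.
Hypothesis cf : continuous f.

Lemma continuous_iter n : continuous (iter n f).
Proof.
elim: n => [|n IH] x; first exact: cvg_id.
by apply: (@continuous_comp _ _ _ (iter n f) f); [exact: IH|exact: cf].
Qed.

(* A stage is a time [m] with centres [c] and radii [r] of one ball per target;
   only the finitely many targets [j < m] are asked to return at the next stage. *)
Lemma eventually_returning_stage m (c : nat -> X) (r : nat -> R) :
  eventually_returning f ->
  (forall j, 0 < r j) ->
  exists m' c' r', [/\ (m < m')%N, forall j, 0 < r' j,
    forall j y, mdist (c' j) y <= r' j -> mdist (c j) y < r j &
    forall j, (j < m)%N -> r' j <= r j / 2 /\
      forall y, mdist (c' j) y <= r' j -> mdist (c j) (iter m' f y) < r j].
Proof.
move=> [n [_ hn ret]] r0.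
have /choice[x Hx] : forall j, exists y, mdist (c j) y < r j /\
    \forall k \near \oo, mdist (c j) (iter (n k) f y) < r j.
  move=> j; have [|y] := ret _ (@open_mdist_lt (c j) (r j)); last by exists y.
  by exists (c j) => /=; rewrite mdistxx.
have [k [km kr]] : exists k, (m < n k)%N /\
    forall i : 'I_m, mdist (c i) (iter (n k) f (x i)) < r i.
  have ret_m : \forall k \near \oo, forall i : 'I_m,
      mdist (c i) (iter (n k) f (x i)) < r i.
    by apply: filter_forall => i; have [_] := Hx i.
  have late : \forall k \near \oo, (m < n k)%N.
    by exists m.+1 => // i /= mi; apply: leq_trans mi _; exact: homo_ltn_ge.
  exact: filter_ex (filterI late ret_m).
(* For [j < m], continuity of [iter (n k) f] at [x j] lets a whole small ball return with its
   centre. *)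
have /choice[r' Hr'] : forall j, exists e : R, [/\ 0 < e, e <= r j / 2 &
    forall y, mdist (x j) y <= e -> mdist (c j) y < r j /\
      ((j < m)%N -> mdist (c j) (iter (n k) f y) < r j)].
  move=> j; apply: mdist_le_in_nbhs; last by rewrite divr_gt0.
  apply: filterI.
    by apply: open_nbhs_nbhs; split; [exact: open_mdist_lt|have [] := Hx j].
  have [jm|jm] := boolP (j < m)%N; last exact: nearW.
  apply: filterS (_ : nbhs (x j) (iter (n k) f @^-1` [set y | mdist (c j) y < r j])).
    by move=> y /= Hy _.
  apply: continuous_iter; apply: open_nbhs_nbhs; split; first exact: open_mdist_lt.
  exact: (kr (Ordinal jm)).
exists (n k), x, r'; split => // [j|j y|j jm]; have [? ? Hj] := Hr' j => //.
  by move=> /Hj[].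
by split => // y /Hj[_]; exact.
Qed.

(** Stage times are at least their index, so from stage [j.+1] on the ball of target [j] returns and
    halves its radius at every stage; [z j] and its image then share a shrinking ball. *)
Lemma eventually_returning_cvg (x : nat -> X) (e : nat -> R) : complete_space X ->
  eventually_returning f -> (forall j, 0 < e j) ->
  exists n : nat -> nat, [/\ forall k, (0 < n k)%N, {homo n : i j / (i < j)%N} &
    exists z : nat -> X, forall j, mdist (x j) (z j) < e j /\
      (fun k => iter (n k) f (z j)) @ \oo --> z j].
Proof.
move=> complX rf e0.
pose S := (nat * (nat -> X) * (nat -> R))%type.
pose good (s : S) := forall j, 0 < s.2 j.
pose next (s t : S) := [/\ (s.1.1 < t.1.1)%N, good t,
  forall j y, mdist (t.1.2 j) y <= t.2 j -> mdist (s.1.2 j) y < s.2 j &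
  forall j, (j < s.1.1)%N -> t.2 j <= s.2 j / 2 /\
    forall y, mdist (t.1.2 j) y <= t.2 j ->
      mdist (s.1.2 j) (iter t.1.1 f y) < s.2 j].
have /choice[step Hstep] : forall s, exists t, good s -> next s t.
  move=> [[m c] r].
  have [gr|ngr] := pselect (good (m, c, r)); last by exists (m, c, r).
  have [m' [c' [r' ?]]] := eventually_returning_stage m c rf gr.
  by exists (m', c', r').
pose s k := iter k step (0%N, x, e) : S.
have gs k : good (s k) by elim: k => // k /Hstep[].
have ns k : next (s k) (s k.+1) := Hstep _ (gs k).
have hm : {homo (fun k => (s k).1.1) : i j / (i < j)%N}.
  by apply: homo_ltn => [? ? ?|k]; [exact: ltn_trans|have [] := ns k].
have mk k : (k <= (s k).1.1)%N by exact: (homo_ltn_ge _ hm).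
have half j k : (s (j.+1 + k)%N).2 j <= (s j.+1).2 j / 2 ^+ k.
  elim: k => [|k IH]; first by rewrite addn0 divr1.
  have [_ _ _ /(_ j)[|+ _]] := ns (j.+1 + k)%N.
    by apply: leq_trans (mk _); rewrite leq_addr.
  rewrite addnS => /le_trans; apply.
  by rewrite exprSr invfM mulrA ler_pM2r // invr_gt0.
have small j d : 0 < d -> exists2 k, (j < k)%N & (s k).2 j < d.
  (* [2 ^ Num.bound a] exceeds [a], so that many halvings after stage [j.+1] bring the radius below
     [d]. *)
  move=> d0; pose a := (s j.+1).2 j / d.
  exists (j.+1 + Num.bound a)%N; first by rewrite leq_addr.
  apply: le_lt_trans (half _ _) _.
  rewrite ltr_pdivrMr ?exprn_gt0 // mulrC -ltr_pdivrMr //.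
  apply: lt_le_trans (archi_boundP _) _; first by rewrite divr_ge0 ?ltW // gs.
  by rewrite -natrX ler_nat ltnW // ltn_expl.
have mono j k i : (k <= i)%N -> (j < k)%N -> (s i).2 j <= (s k).2 j.
  move=> ki jk; rewrite -(subnKC ki); elim: (i - k)%N => [|l IH].
    by rewrite addn0.
  have [_ _ _ /(_ j)[|+ _]] := ns (k + l)%N.
    by apply: leq_trans (mk _); rewrite (leq_trans jk) ?leq_addr.
  rewrite addnS => /le_trans; apply; apply: le_trans IH.
  by rewrite ler_pdivrMr // ler_peMr ?ler1n // ltW // gs.
have /choice[z Hz] : forall j, exists y, forall k,
    mdist ((s k).1.2 j) y < (s k).2 j.
  move=> j; apply: nested_balls => // [d /(small j)[k _]|k|k]; first by exists k.
    by have [_ _ + _] := ns k; exact.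
  exact: gs.
(* The shift drops the initial time [0], so all times are positive. *)
exists (fun k => (s k.+1).1.1); split.
- by move=> k; apply: leq_ltn_trans (hm _ _ (ltnSn k)).
- by move=> i j ij; exact: hm.
exists z => j; split; first exact: (Hz j 0%N).
apply/metricType_numDomainType.cvgrPdist_lt => d d0.
have [k jk Hk] := small j (d / 2) (divr_gt0 d0 (ltr0Sn _ _)).
exists k => // i /= ki.
(* [z j] and its image both lie in the ball of stage [i], whose radius is below [d / 2]. *)
have [_ _ _ /(_ j)[|_ /(_ (z j) (ltW (Hz _ _))) ret]] := ns i.
  by apply: leq_trans (mk _); exact: leq_trans jk ki.
have ri := le_lt_trans (mono _ _ _ ki jk) Hk.
apply: le_lt_trans (metric_triangle _ ((s i).1.2 j) _) _.
rewrite metric_sym (splitr d) ltrD // (lt_trans _ ri) //; exact: Hz.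
Qed.

End nested_returns.

(** Each pair of a point of [D] and a scale [1 / (m + 1)], coded as one natural number, is a target;
    the returning points so obtained are dense. *)
Lemma eventually_returning_quasi_rigid (R : realType) (X : metricType R)
    (f : X -> X) :
  continuous f -> separable_space X -> complete_space X -> eventually_returning f ->
  quasi_rigid f.
Proof.
move=> cf [D [cD dD]] complX rf.
have [[x0 _]|X0] := pselect (exists x : X, True); last first.
  exists succn; split => //; exists setT; split=> [O [y _]|y].
    by case: X0; exists y.
  by case: X0; exists y.
have [|e De] := countable_range cD.
  by have [|y [_ Dy]] := dD setT _ openT; [exists x0|exists y].
pose p j : nat * nat := odflt (0, 0)%N (choice.unpickle j).
have [|n [n0 hn [z Hz]]] := eventually_returning_cvg cf (fun j => e (p j).1)
  (e := fun j => (p j).2.+1%:R^-1) complX rf; first by move=> j; rewrite invr_gt0.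
exists n; split => //; exists (range z); split; last first.
  by move=> _ [j _ <-]; have [] := Hz j.
move=> O [o Oo] oO.
have [|d [d0 _ dO]] := @mdist_le_in_nbhs _ _ o O 1 _ ltr01; first exact: open_nbhs_nbhs.
have [|y [/= oy]] := dD _ _ (open_mdist_lt o (d / 2)).
  by exists o => /=; rewrite mdistxx divr_gt0.
rewrite De => -[i _ ei].
(* This [m] makes [1 / (m + 1)] smaller than [d / 2]; the other half of [d] covers the distance from
   [o] to [y]. *)
pose m := Num.bound (d / 2)^-1.
exists (z (choice.pickle (i, m))); split; last by exists (choice.pickle (i, m)).
apply: dO; have [+ _] := Hz (choice.pickle (i, m)); rewrite /p choice.pickleK /= => zm.
apply: le_trans (metric_triangle _ y _) _.
rewrite (splitr d) lerD ?(ltW oy) // -ei (ltW (lt_trans zm _)) //.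
rewrite invf_plt ?posrE ?divr_gt0 //.
apply: lt_le_trans (archi_boundP _) _; last by rewrite ler_nat.
by rewrite invr_ge0 divr_ge0 ?ltW.
Qed.

(** * The hyperspace of compact sets *)

Section hyperspace_rigidity.
Variables (X : topologicalType) (f : X -> X).
Hypothesis cf : continuous f.

Lemma vietoris_nbhs (K : hyperspace X) (W : set (hyperspace X)) : nbhs K W ->
  exists (N : nat) (U : 'I_N -> set X),
    [/\ forall j, open (U j), vietoris_open U K & vietoris_open U `<=` W].
Proof.
rewrite nbhsE => -[O [[B Bbase <-] [V BV VK]] OW].
have [N [U [_ oU _ VU]]] := Bbase _ BV; exists N, U; rewrite -VU; split => //.
by move=> L VL; apply: OW; exists V.
Qed.

Lemma iter_hyper_map n (K : hyperspace X) :
  (iter n (hyper_map cf) K : set X) = iter n f @` K.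
Proof.
elim: n => [|n IH]; first by rewrite image_id.
by rewrite iterS /= IH image_comp.
Qed.

Definition hyper_fset (s : {fset X}) (s0 : [set` s] !=set0) : hyperspace X :=
  Hyperspace (finite_compact (finite_fset s)) s0.

(** Finite subsets of [Z] return, since a basic Vietoris neighbourhood of one imposes finitely many
    eventual conditions. *)
Lemma quasi_rigid_hyper : quasi_rigid f -> quasi_rigid (hyper_map cf).
Proof.
move=> [n [n0 hn [Z [dZ Zf]]]]; exists n; split => //.
exists [set K | exists (s : {fset X}) (s0 : [set` s] !=set0),
  [set` s] `<=` Z /\ K = hyper_fset s0].
split.
  move=> O [K OK] oO.
  have [|N [U [oU [KU Kj] UO]]] := @vietoris_nbhs K O; first exact: open_nbhs_nbhs.
  have /choice[z Hz] : forall j, exists y, U j y /\ Z y.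
    move=> j; have [x [_ Ux]] := Kj j.
    by have [|y [Uy Zy]] := dZ (U j) _ (oU j); [exists x|exists y].
  have zN j : z j \in [fset z i | i in 'I_N]%fset by apply/imfsetP; exists j.
  have s0 : [set` [fset z i | i in 'I_N]%fset] !=set0.
    (* The nonempty [K] is covered by the [U j], so an index exists. *)
    have [x /KU[j _ _]] := hyper_nonempty K.
    by exists (z j); exact: zN.
  exists (hyper_fset s0); split; last first.
    exists [fset z i | i in 'I_N]%fset, s0; split => // _ /imfsetP[j _ ->].
    by have [] := Hz j.
  apply: UO; split=> [_ /imfsetP[j _ ->]|j].
    by exists j => //; have [] := Hz j.
  by exists (z j); split; [exact: zN|have [] := Hz j].
move=> _ [s [s0 [sZ ->]]] W /vietoris_nbhs[N [U [oU [KU Kj] UW]]].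
have [x Hx] := choice Kj.
have cvgU V y : open V -> V y -> y \in s ->
    \forall k \near \oo, V (iter (n k) f y).
  by move=> oV Vy ys; apply: (Zf _ (sZ _ ys)); exact: open_nbhs_nbhs.
(* [stay] keeps every [U j] hit, tracking one point per index; [cover] keeps the image inside the
   union, tracking every point of [s]. *)
have stay : \forall k \near \oo, forall j, U j (iter (n k) f (x j)).
  by apply: filter_forall => j; have [sx Ux] := Hx j; exact: cvgU.
have cover : \forall k \near \oo,
    (\bigcap_(y in [set` s]) [set l | (\bigcup_j U j) (iter (n l) f y)]) k.
  apply: filter_bigI => y ys; apply: cvgU => //; last exact: KU.
  exact: bigcup_open.
apply: filterS (filterI stay cover) => k [kU ks]; apply: UW; split.
  by rewrite iter_hyper_map => _ [y ys <-]; exact: ks.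
move=> j; exists (iter (n k) f (x j)); split; last exact: kU.
by rewrite iter_hyper_map; exists (x j) => //; have [] := Hx j.
Qed.

(** The compact subsets of [U] form an open set, so a returning [K] inside [U] eventually has its
    image inside [U]; any point of [K] then serves. *)
Lemma quasi_rigid_hyper_eventually_returning :
  quasi_rigid (hyper_map cf) -> eventually_returning f.
Proof.
move=> [n [n0 hn [Z [dZ Zf]]]]; exists n; split => // U oU U0.
pose V : set (hyperspace X) := vietoris_open (fun _ : unit => U).
have oV : open V.
  exists [set V]; last by rewrite bigcup_set1.
  by move=> _ ->; apply: (@vietoris_base_fin _ unit tt).
have [|K [[KU _] ZK]] := dZ V _ oV.
  have [x Ux] := U0; have s0 : [set` [fset x]%fset] !=set0 by exists x; rewrite /= inE.
  exists (hyper_fset s0); split=> [y|_]; first by rewrite /= inE => /eqP ->; exists tt.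
  by exists x; split => //=; rewrite inE.
have [x Kx] := hyper_nonempty K; exists x; first by have [] := KU _ Kx.
have : \forall k \near \oo, V (iter (n k) (hyper_map cf) K).
  apply: (Zf _ ZK); apply: open_nbhs_nbhs; split => //; split => // _.
  by exists x; split => //; have [] := KU _ Kx.
apply: filterS => k [+ _]; rewrite iter_hyper_map => kU.
by have [|_ _] := kU (iter (n k) f x); first by exists x.
Qed.

End hyperspace_rigidity.

(** * Finitely supported fuzzy sets and their density *)

Section fuzzy_rigidity.
Variables (R : realType) (X : metricType R).
Implicit Types u v : X -> R.

(** This carries estimates on the set where a fuzzy set is positive over to its level [0]. *)
Lemma set_dist_closure_le (x : X) (A B : set X) (e : R) : closure A x ->
  (forall y, A y -> exists2 z, B z & mdist y z <= e) -> set_dist x B <= e.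
Proof.
move=> clA AB; apply/ler_addgt0Pr => d d0.
have [y [Ay xy]] := clA _ (nbhsx_ballx x d d0).
have [z Bz yz] := AB _ Ay; apply: le_trans (set_dist_le x Bz) _.
apply: le_trans (metric_triangle _ y _) _; rewrite addrC lerD //.
by move: xy; rewrite ballEmdist => /ltW.
Qed.

(** The [y] found for [x] lies in every positive level of [v] up to [u x], so one choice treats all
    positive levels; level [0] follows by closure. *)
Lemma supremum_dist_le_pointwise u v (e : R) : is_fuzzy u -> is_fuzzy v ->
  (forall x, 0 < u x -> exists2 y, u x <= v y & mdist x y <= e) ->
  (forall x, 0 < v x -> exists2 y, v x <= u y & mdist x y <= e) ->
  supremum_dist u v <= e.
Proof.
have half (w1 w2 : X -> R) a (x : X) :
    (forall x, 0 < w1 x -> exists2 y, w1 x <= w2 y & mdist x y <= e) ->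
    0 <= a <= 1 -> level w1 a x -> set_dist x (level w2 a) <= e.
  move=> H /andP[]; rewrite le_eqVlt => /predU1P[<- _|a0 _].
    rewrite !level0 => clx; apply: (set_dist_closure_le clx) => y /= y0.
    have [z yz ?] := H _ y0; exists z => //; apply: subset_closure => /=.
    exact: lt_le_trans yz.
  rewrite !level_pos //= => ax; have [y xy] := H x (lt_le_trans a0 ax).
  by apply: le_trans (set_dist_le _ _); exact: le_trans xy.
move=> fu fv uv vu; apply/supremum_dist_leP => // a a01.
have /andP[a0 _] := a01.
apply/hausdorff_dist_leP; do ?exact: level_compact; do ?exact: level_nonempty.
by split=> x; exact: half.
Qed.

(** If [u] stayed below its supremum on [K], semicontinuity and compactness would give a uniform
    bound [c] strictly below it. *)
Lemma usc_attains_sup u (K : set X) :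
  (forall x a, u x < a -> \forall y \near x, u y < a) ->
  compact K -> K !=set0 -> has_ubound (u @` K) ->
  exists2 x, K x & u x = sup (u @` K).
Proof.
move=> usc cK [k Kk] ubK; apply: contrapT => nx.
have below x : K x -> u x < sup (u @` K).
  move=> Kx; rewrite lt_neqAle; apply/andP; split.
    by apply/eqP => ux; apply: nx; exists x.
  by apply: ub_le_sup => //; exists x.
have := (compact_near_coveringP _).1 cK R (at_left (sup (u @` K)))
  (fun b y => u y < b) _.
case.
  move=> x Kx; pose b := (u x + sup (u @` K)) / 2.
  have ub : u x < b by rewrite /b midf_lt // below.
  have ba : b < sup (u @` K) by rewrite /b midf_lt // below.
  exists ([set t | u t < b], [set c | b <= c]).
    by split => /=; [exact: usc|exact: nbhs_left_ge].
  by move=> [t c] /= [+ bc]; move=> /lt_le_trans; exact.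
move=> d /= d0 Hd.
pose c := sup (u @` K) - d / 2.
have cs : c < sup (u @` K) by rewrite gtrBl divr_gt0.
have Kc : K `<=` (fun y => u y < c).
  apply: Hd => //=; rewrite opprB addrC subrK ger0_norm ?divr_ge0 ?ltW //.
  by rewrite ltr_pdivrMr // ltr_pMr // ltr1n.
move: cs; rewrite ltNge => /negP; apply; apply: ge_sup; first by exists (u k), k.
by move=> _ [y Ky <-]; exact/ltW/Kc.
Qed.

Lemma is_fuzzy_finite (s : {fset X}) u : (forall x, 0 <= u x <= 1) ->
  (forall x, x \notin s -> u x = 0) -> (exists x, 1 <= u x) -> is_fuzzy u.
Proof.
move=> u01 us [x1 ux1].
have cl (A : set X) : finite_set A -> closed A.
  apply: (accessible_finite_set_closed.1 _ A).
  exact/hausdorff_accessible/metric_hausdorff.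
split => //.
- move=> x a ua.
  (* Off the finite set [s] minus [x], a point is [x] itself or has value [0], which is at most
     [u x]. *)
  have : nbhs x (~` [set` s `\ x]%fset).
    apply: open_nbhs_nbhs; split; first by rewrite openC; exact: cl.
    by rewrite /= !inE eqxx.
  apply: filterS => y /= /negP; rewrite !inE negb_and negbK => /orP[/eqP-> //|ys].
  by rewrite us //; apply: le_lt_trans ua; have /andP[] := u01 x.
- have us0 : [set x | 0 < u x] `<=` [set` s].
    move=> x /=; apply: contraTT => /us ->; by rewrite ltxx.
  apply: (subclosed_compact _ (finite_compact (finite_fset s))).
    by rewrite level0; exact: closed_closure.
  rewrite level0 [X in _ `<=` X](closure_id _).1; first exact: closureS.
  by apply: cl; exact: finite_fset.
- by exists x1; rewrite level_pos.
Qed.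

Lemma finite_net (K Z : set X) (e : R) : compact K -> dense Z -> 0 < e ->
  exists2 s : {fset X}, [set` s] `<=` Z &
    forall x, K x -> exists2 z, z \in s & mdist z x < e.
Proof.
move=> cK dZ e0.
have [[x0 _]|X0] := pselect (exists x : X, True); last first.
  by exists fset0 => // x; case: X0; exists x.
(* [compact_cover] is only available on pointed spaces. *)
pose Xp : ptopologicalType :=
  HB.pack (X : Type) (X : topologicalType) (isPointed.Build (X : Type) x0).
have : @cover_compact Xp K by rewrite -compact_cover.
move=> /(_ X Z (fun z => [set y | mdist z y < e])) [z _|x _|s sZ sK].
- exact: open_mdist_lt.
- have [|y [/= xy Zy]] := dZ _ _ (open_mdist_lt x e).
    by exists x; rewrite /= mdistxx.
  by exists y => //=; rewrite metric_sym.
- exists s => [z /sZ|x /sK[z zs zx]]; first by rewrite inE.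
  by exists z.
Qed.

Definition finitely_supported (Z : set X) : set (X -> R) :=
  [set u | exists2 s : {fset X}, [set` s] `<=` Z & forall x, x \notin s -> u x = 0].

(** Each net point receives the maximum of [u] over a closed [e]-ball within level [0]. A net point
    near [x] then has value at least [u x], and each positive value is attained by [u] within
    [e]. *)
Lemma dense_finitely_supported (Z : set X) (u : fuzzy R X) (e : R) :
  dense Z -> 0 < e ->
  exists2 v : fuzzy R X, finitely_supported Z v & supremum_dist u v <= e.
Proof.
move=> dZ e0; have fu := fuzzyP u; have [u01 usc cu [x1 ux1]] := fu.
have [s sZ sK] := finite_net cu dZ e0.
(* [v z] is an exact value of [u] near [z], as [d_infty] does not tolerate errors
   in the values. *)
pose B z := level u 0 `&` [set y | mdist z y <= e].
pose b z := sup (u @` B z).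
have ubB z : has_ubound (u @` B z).
  by exists 1 => _ [y _ <-]; have /andP[] := u01 y.
have cB z : compact (B z).
  apply: (subclosed_compact _ cu) => [|y []//].
  apply: closedI; first exact: closed_level.
  rewrite -openC openE => y /= /negP; rewrite -ltNge => zy.
  apply/nbhs_ballP; exists (mdist z y - e); first by rewrite /= subr_gt0.
  move=> w; rewrite ballEmdist /= => yw; apply/negP; rewrite -ltNge.
  move: yw; rewrite ltrBrDr => /lt_le_trans /(_ (metric_triangle _ w _)).
  by rewrite (metric_sym w) addrC ltrD2r.
have ub z y : B z y -> u y <= b z by move=> By; apply: ub_le_sup => //; exists y.
have pos y : 0 < u y -> level u 0 y by rewrite level0 => ?; exact: subset_closure.
have b_attained z : B z !=set0 -> exists2 y, B z y & u y = b z.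
  by move=> B0; exact: usc_attains_sup.
(* The supremum of the empty set is [0], so a net point far from level [0] gets value [0]. *)
have b0 z : ~ (B z !=set0) -> b z = 0.
  by move=> /set0P/negP/negPn/eqP; rewrite /b => ->; rewrite image_set0 sup0.
have b01 z : 0 <= b z <= 1.
  have [/b_attained[y _ <-]|/b0 ->] := pselect (B z !=set0); first exact: u01.
  by rewrite lexx ler01.
pose v x := if x \in s then b x else 0.
have uv x : 0 < u x -> exists2 y, u x <= v y & mdist x y <= e.
  move=> ux0; have [z zs zx] := sK x (pos _ ux0).
  exists z; last by rewrite metric_sym ltW.
  by rewrite /v zs; apply: ub; split; [exact: pos|exact: ltW].
have fv : is_fuzzy v.
  apply: (@is_fuzzy_finite s) => [x|x /negbTE|].
  - by rewrite /v; case: ifP => // _; rewrite lexx ler01.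
  - by rewrite /v => ->.
  - move: ux1; rewrite level_pos //= => ux1.
    have [|y uy _] := uv x1; first exact: lt_le_trans ux1.
    by exists y; exact: le_trans uy.
exists (Fuzzy fv); first by exists s => // x /negbTE; rewrite /= /v => ->.
apply: supremum_dist_le_pointwise => // x /=; rewrite /v; case: ifP; last by rewrite ltxx.
move=> xs bx0; have [|y [_ xy] uy] := b_attained x; last by exists y; rewrite ?uy.
by apply: contrapT => /b0 bx; rewrite bx ltxx in bx0.
Qed.

(** * Returns of the Zadeh extension in both metrics *)

Variable f : X -> X.
Hypothesis cf : continuous f.

(** Positive levels are pushed forward exactly because the supremum over a fibre is attained. *)
Lemma le_iter_zadehP n (u : fuzzy R X) x a : 0 < a ->
  a <= iter n (zadeh_map cf) u x <-> exists2 y, iter n f y = x & a <= u y.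
Proof.
move=> a0; elim: n x => [|n IH] x.
  by split=> [ax|[y <-]//]; exists x.
rewrite iterS; split=> [/(le_zadehP cf x (fuzzyP _) a0)[y <- /IH[z <- az]]|].
  by exists z.
move=> [z <- az]; apply/(le_zadehP cf _ (fuzzyP _) a0); exists (iter n f z) => //.
by apply/IH; exists z.
Qed.

(** Moving support points by [iter (n k) f] does not lower values, and each positive value of the
    iterate comes from a support point; finiteness of [s] makes the displacement uniformly small. *)
Lemma cvg_iter_zadeh (n : nat -> nat) (Z : set X) (u : fuzzy R X) (e : R) :
  (forall x, Z x -> (fun k => iter (n k) f x) @ \oo --> x) ->
  finitely_supported Z u -> 0 < e ->
  \forall k \near \oo, supremum_dist u (iter (n k) (zadeh_map cf) u) <= e.
Proof.
move=> Zf [s sZ us] e0.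
have : \forall k \near \oo,
    (\bigcap_(x in [set` s]) [set l | mdist x (iter (n l) f x) < e]) k.
  apply: filter_bigI => x xs.
  exact: (metricType_numDomainType.cvgr_dist_lt (Zf _ (sZ _ xs)) e0).
have supp x : 0 < u x -> x \in s.
  by apply: contraTT => /us ->; rewrite ltxx.
apply: filterS => k ks; apply: supremum_dist_le_pointwise; do ?exact: fuzzyP.
- move=> x x0; exists (iter (n k) f x); last exact: ltW (ks x (supp _ x0)).
  by apply/le_iter_zadehP => //; exists x.
- move=> x x0; have [y yx xy] := (le_iter_zadehP _ u x x0).1 (lexx _).
  exists y => //; rewrite metric_sym -yx; apply/ltW/ks/supp.
  exact: lt_le_trans xy.
Qed.

Lemma quasi_rigid_supremum : quasi_rigid f ->
  @quasi_rigid (fuzzy_supremum X) (zadeh_map cf).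
Proof.
move=> [n [n0 hn [Z [dZ Zf]]]]; exists n; split => //.
exists [set u | finitely_supported Z (u : fuzzy R X)]; split.
  move=> O [u Ou] oO.
  have /nbhs_ballP[e /= e0 eO] : nbhs u O by exact: open_nbhs_nbhs.
  have [v Zv uv] := dense_finitely_supported u dZ (divr_gt0 e0 (ltr0Sn R 1)).
  exists v; split => //; apply: eO; rewrite ballEmdist /=.
  by apply: le_lt_trans uv _; rewrite ltr_pdivrMr // ltr_pMr // ltr1n.
move=> u Zu; apply/metricType_numDomainType.cvgrPdist_lt => e e0.
apply: filterS (cvg_iter_zadeh Zf Zu (divr_gt0 e0 (ltr0Sn R 1))) => k uk.
by apply: le_lt_trans uk _; rewrite ltr_pdivrMr // ltr_pMr // ltr1n.
Qed.

Lemma skorokhod_le_supremum (u v : fuzzy R X) :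
  skorokhod_dist u v <= supremum_dist u v.
Proof.
apply: (@skorokhod_dist_le _ _ _ _ _ id); do ?exact: fuzzyP.
- exact: increasing_homeo01_id.
- by move=> a _; rewrite subrr normr0; apply: supremum_dist_ge0; exact: fuzzyP.
- exact: lexx.
Qed.

(** Since [d_0 <= d_infty], density and convergence pass over with the same [Z] and the same
    times. *)
Lemma quasi_rigid_supremum_skorokhod (g : fuzzy R X -> fuzzy R X) :
  @quasi_rigid (fuzzy_supremum X) g -> @quasi_rigid (fuzzy_skorokhod X) g.
Proof.
move=> [n [n0 hn [Z [dZ Zf]]]]; exists n; split => //; exists Z; split.
  move=> O [u Ou] oO.
  have /nbhs_ballP[e /= e0 eO] : nbhs u O by exact: open_nbhs_nbhs.
  have [|v [/= uv Zv]] := dZ _ _ (@open_mdist_lt R (fuzzy_supremum X) u e).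
    by exists u; rewrite /= mdistxx.
  exists v; split => //; apply: eO; rewrite ballEmdist /=.
  exact: le_lt_trans (skorokhod_le_supremum _ _) uv.
move=> u Zu; apply/metricType_numDomainType.cvgrPdist_lt => e e0.
apply: filterS (metricType_numDomainType.cvgr_dist_lt (Zf u Zu) e0) => k.
exact: le_lt_trans (skorokhod_le_supremum _ _).
Qed.

(** A reparametrisation fixes [1] and so leaves the top level unchanged; hence Skorokhod closeness
    still controls top levels in Hausdorff distance. *)
Lemma skorokhod_dist_lt_top (u v : fuzzy R X) (e : R) y :
  skorokhod_dist u v < e -> 1 <= v y -> exists2 x, 1 <= u x & mdist x y < e.
Proof.
have [fu fv] := (fuzzyP u, fuzzyP v).
move=> /(skorokhod_dist_lt fu fv)[xi [e' [hxi e'e _ uv]]] vy.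
have fxv := is_fuzzy_comp hxi fv.
have i1 : 0 <= (1 : R) <= 1 by rewrite lexx ler01.
have xi1 : xi 1 = 1.
  have [h [eta [[s t] K L _ _]]] := hxi.
  by have [_ _ [_ ->]] := increasing_homeo01_bijP h s t L.
have v1 : v y = 1.
  by apply/eqP; rewrite eq_le vy andbT; have [/(_ y)/andP[]] := fv.
have [_ /(_ y) top] := (hausdorff_dist_leP _ (level_compact fu ler01)
    (level_nonempty fu i1) (level_compact fxv ler01) (level_nonempty fxv i1)).1
    ((supremum_dist_leP _ fu fxv).1 uv 1 i1).
have : level (xi \o v) 1 y by rewrite level_pos //= v1 xi1.
move=> /top /le_lt_trans /(_ e'e) /(set_dist_lt (level_nonempty fu i1))[x ux xy].
by exists x; [move: ux; rewrite level_pos|rewrite metric_sym].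
Qed.

(** The indicator of a point [x] of [U] is approximated by a returning [v], whose top level lies
    near [x]. Images of a top point [y] of [v] eventually stay near that level, hence in [U]. *)
Lemma quasi_rigid_skorokhod_eventually_returning :
  @quasi_rigid (fuzzy_skorokhod X) (zadeh_map cf) -> eventually_returning f.
Proof.
move=> [n [n0 hn [Z [dZ Zf]]]]; exists n; split => // U oU [x Ux].
have [|e [e0 _ eU]] := @mdist_le_in_nbhs _ _ x U 1 _ ltr01.
  exact: open_nbhs_nbhs.
have e20 : 0 < e / 2 by rewrite divr_gt0.
have fx : is_fuzzy (fun y => (y == x)%:R : R).
  apply: (@is_fuzzy_finite [fset x]%fset) => [y|y|].
  - by case: eqP; rewrite lexx ler01.
  - by rewrite inE => /negbTE ->.
  - by exists x; rewrite eqxx.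
have top y : 1 <= (y == x)%:R :> R -> y = x.
  by case: eqP => // _; rewrite leNgt ltr01.
have [|v [/= xv Zv]] :=
    dZ _ _ (@open_mdist_lt R (fuzzy_skorokhod X) (Fuzzy fx) (e / 2)).
  by exists (Fuzzy fx); rewrite /= mdistxx.
have near_x y : 1 <= (v : fuzzy R X) y -> mdist x y < e / 2.
  by move=> /(skorokhod_dist_lt_top xv)[z /top ->].
have [_ _ _ [y]] := fuzzyP v; rewrite level_pos //= => vy; exists y.
  by apply: eU; apply: le_trans (ltW (near_x _ vy)) _;
    rewrite ler_pdivrMr // ler_peMr ?ler1n // ltW.
apply: filterS (metricType_numDomainType.cvgr_dist_lt (Zf v Zv) e20) => k vk.
have [|z /near_x xz zy] := skorokhod_dist_lt_top (y := iter (n k) f y) vk.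
  by apply/le_iter_zadehP => //; exists y.
apply: eU; apply: le_trans (metric_triangle _ z _) _.
by rewrite (splitr e) lerD // ltW.
Qed.

End fuzzy_rigidity.

(** * Closing the cycle of implications *)

Theorem corollary5p3 (R : realType) (X : metricType R) (f : X -> X)
    (cf : continuous f) (sepX : separable_space X) (complX : complete_space X) :
  [<-> quasi_rigid f;
       @quasi_rigid (hyperspace X) (hyper_map cf);
       @quasi_rigid (fuzzy_supremum X) (zadeh_map cf);
       @quasi_rigid (fuzzy_skorokhod X) (zadeh_map cf)].
Proof.
(* This is the way back to [f]: (ii) to (iii) passes through (i), and (iv) leads to (i) directly. *)
have to_f := eventually_returning_quasi_rigid cf sepX complX.
tfae.
- exact: quasi_rigid_hyper.
- by move=> /quasi_rigid_hyper_eventually_returning /to_f; exact: quasi_rigid_supremum.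
- exact: quasi_rigid_supremum_skorokhod.
- by move=> /quasi_rigid_skorokhod_eventually_returning; exact: to_f.
Qed.
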